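(* Suppose $m\le d/2$ and the predictions $\hat\theta_1,\dots,\hat\theta_m$ are mutually orthogonal. There exist positive constants $C_1,C_2$ depending only on $\alpha$ and $\beta$ such that the following holds. Let $\epsilon:\mathbb{R}_+^m\to[0,\infty)$ be a separation curve such that, for every $r\in\mathbb{R}_+^m$ with $S_{\epsilon(r)}\cap B_r\ne\emptyset$, $$\epsilon(r)\ \ge\ C_1\cdot\inf\Big\{\epsilon\ge0:\ n\ge C_2\cdot\Big(\frac{\sqrt m}{\gamma_*^2(\epsilon,r)}\wedge\frac{\sqrt d}{\epsilon^2}\Big)\ \text{ and }\ S_\epsilon\cap B_r\neq\emptyset\Big\}.$$ Then the hypotheses $$H_0:\theta=0\quad\text{versus}\quad H_1:\ \exists\, r\in\mathbb{R}_+^m\text{ with } S_{\epsilon(r)}\cap B_r\ne\emptyset \text{ such that } \|\theta\|_2\ge\epsilon(r)\text{ and }\|\theta-\hat\theta_i\|_2\le r_i\text{ for all } i\in[m]$$ can be tested with nontrivial power.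
   Context: $d,n,m\ge1$ are integers and $\hat\theta_1,\dots,\hat\theta_m\in\mathbb{R}^d$ are fixed nonzero vectors (predictions). One observes $X\sim P_\theta=\mathcal N(\theta,I_d/n)$ with unknown $\theta\in\mathbb{R}^d$. Fix $\alpha\in(0,1)$, $\beta\in(0,1-\alpha)$. A test is a measurable $\psi:\mathbb{R}^d\to\{0,1\}$ (it does not know the vector $r$ in the alternative); it is valid if $P_0(\psi(X)=1)\le\alpha$. A valid test is powerful if $\sup P_\theta(\psi(X)=0)<\beta$, the supremum being over all $\theta$ in the alternative $H_1$. ''Can be tested with nontrivial power'' means that a valid and powerful test exists. $S_\epsilon=\{\theta:\|\theta\|_2=\epsilon\}$; $B_r=\bigcap_{i=1}^m\{\theta:\|\theta-\hat\theta_i\|_2\le r_i\}$; $\hat U\in\mathbb{R}^{d\times m}$ has columns $\hat u_i=\hat\theta_i/\|\hat\theta_i\|_2$; $\Pi_{\hat U}$ is the orthogonal projection onto the column span of $\hat U$; $\gamma_*^2(\epsilon,r)=\inf_{\theta\in S_\epsilon\cap B_r}\|\Pi_{\hat U}\theta\|_2^2$. $a\wedge b=\min(a,b)$, $1/0=+\infty$, $\inf\emptyset=+\infty$. *)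

(* Defs.v *)
From HB Require Import structures.
From mathcomp Require Export all_boot all_order all_algebra.
From mathcomp Require Export all_classical all_reals all_analysis.

Set Implicit Arguments.
Unset Strict Implicit.
Unset Printing Implicit Defensive.

Import Order.TTheory GRing.Theory Num.Theory.
Import numFieldNormedType.Exports.

Local Open Scope classical_set_scope.
Local Open Scope ring_scope.

Section ProductLaw.
Context (d : measure_display) (T : measurableType d) (R : realType).

Definition tcons (k : nat) (p : T * k.-tuple T) : k.+1.-tuple T :=
  [the k.+1.-tuple T of p.1 :: p.2].

Lemma measurable_tcons k : measurable_fun [set: T * k.-tuple T] (@tcons k).
Proof. exact: measurable_cons. Qed.

HB.instance Definition _ k := @isMeasurableFun.Build _ _ _ _ (@tcons k)
  (@measurable_tcons k).

Fixpoint product_law (k : nat) :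
    ('I_k -> probability T R) -> probability (k.-tuple T) R :=
  match k with
  | 0 => fun _ => dirac ([tuple] : 0.-tuple T)
  | k'.+1 => fun P =>
      distribution (P ord0 \x product_law (fun i => P (lift ord0 i)))%E
                   (@tcons k')
  end.

Lemma product_lawE (k : nat) (P : 'I_k -> probability T R)
    (A : 'I_k -> set T) : (forall i, measurable (A i)) ->
  product_law P [set t | forall i, A i (tnth t i)] = (\prod_i P i (A i))%E.
Proof.
elim: k P A => [|k IH] P A mA /=.
  rewrite big_ord0 diracE mem_set//=; by case.
rewrite /distribution/= /pushforward.
pose B := [set t : k.-tuple T | forall i, A (lift ord0 i) (tnth t i)].
have -> : @tcons k @^-1` [set t | forall i, A i (tnth t i)] = A ord0 `*` B.
  apply/seteqP; split => -[x t] /=.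
    move=> H; split => /=; first by have := H ord0.
    by move=> i; have := H (lift ord0 i); rewrite tnthS.
  by move=> [/= H1 H2] i; case: (unliftP ord0 i) => [j|] ->; rewrite ?tnthS.
rewrite product_measure1E//=.
  rewrite big_ord_recl; congr (_ * _)%E.
  exact: (IH (fun i => P (lift ord0 i)) (fun i => A (lift ord0 i))).
rewrite (_ : B = \bigcap_i (fun t => tnth t i) @^-1` (A (lift ord0 i))).
  apply: fin_bigcap_measurable => // i _; rewrite -[X in measurable X]setTI.
  exact: measurable_tnth.
by apply/seteqP; split => t /= H i; [move=> _; apply: H | exact: H].
Qed.

End ProductLaw.

Section Vectors.
Context (R : realType).

Definition dotv (d : nat) (u v : 'cV[R]_d) : R := \sum_i u i 0 * v i 0.

(* the library norm on matrices is the sup norm *)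
Definition l2norm (d : nat) (u : 'cV[R]_d) : R := Num.sqrt (dotv u u).

(* [proj_mx] acts on row vectors on the right, hence the transpositions;
   [kermx U] is the row space of all [x^T] with [x^T *m U = 0], i.e., the
   orthogonal complement of the column span of [U]. *)
Definition orth_proj (d m : nat) (U : 'M[R]_(d, m)) : 'M[R]_d :=
  (proj_mx <<U^T>>%MS (kermx U))^T.

Lemma dotvE d (u v : 'cV[R]_d) : dotv u v = (u^T *m v) 0 0.
Proof. by rewrite mxE; apply: eq_bigr => i _; rewrite mxE. Qed.

Lemma dotv_eq0 d (u : 'cV[R]_d) : dotv u u = 0 -> u = 0.
Proof.
move=> /eqP; rewrite psumr_eq0; last by move=> i _; rewrite -expr2 sqr_ge0.
move=> /allP H; apply/colP => i; rewrite mxE.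
by have := H i (mem_index_enum _); rewrite -expr2 sqrf_eq0 => /eqP.
Qed.

Lemma kermx_disj d m (U : 'M[R]_(d, m)) : (<<U^T>> :&: kermx U = 0)%MS.
Proof.
apply/eqP; rewrite -submx0; apply/rV_subP => v.
rewrite sub_capmx genmxE => /andP[/submxP[w ->]] /sub_kermxP H.
have : dotv (w *m U^T)^T (w *m U^T)^T = 0.
  by rewrite dotvE trmxK [X in _ *m X]trmx_mul trmxK mulmxA H mul0mx mxE.
move=> /dotv_eq0 /(congr1 trmx); rewrite trmxK trmx0 => ->.
exact: sub0mx.
Qed.

Lemma kermx_compl d m (U : 'M[R]_(d, m)) : (1%:M <= <<U^T>> + kermx U)%MS.
Proof.
rewrite sub1mx -col_leq_rank.
have := mxrank_sum_cap <<U^T>>%MS (kermx U).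
rewrite kermx_disj mxrank0 addn0 mxrank_gen mxrank_tr mxrank_ker => ->.
by rewrite subnKC// rank_leq_row.
Qed.

Lemma orth_proj_span d m (U : 'M[R]_(d, m)) (x : 'cV[R]_d) :
  exists a : 'cV[R]_m, orth_proj U *m x = U *m a.
Proof.
have /submxP[w Hw] : (x^T *m proj_mx <<U^T>>%MS (kermx U) <= U^T)%MS.
  by rewrite -(genmxE U^T) proj_mx_sub.
exists w^T; apply: trmx_inj.
by rewrite /orth_proj trmx_mul trmxK Hw trmx_mul trmxK.
Qed.

Lemma orth_proj_orth d m (U : 'M[R]_(d, m)) (x : 'cV[R]_d) :
  U^T *m (x - orth_proj U *m x) = 0.
Proof.
apply: trmx_inj; rewrite trmx0 trmx_mul trmxK; apply/sub_kermxP.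
rewrite linearB/= trmx_mul /orth_proj trmxK.
apply: proj_mx_compl_sub.
by apply: submx_trans (kermx_compl U); apply: submx1.
Qed.

End Vectors.

Section Testing.
Context (R : realType) (d : nat).

(* [normal_prob] takes the standard deviation as its second parameter *)
Definition gaussian_law (n : nat) (theta : 'cV[R]_d) :
    probability (d.-tuple (measurableTypeR R)) R :=
  product_law (fun i : 'I_d => normal_prob (theta i 0) (Num.sqrt n%:R)^-1).

(* [d.-tuple] carries the product sigma-algebra, i.e., the Borel one on R^d *)
Definition is_test (psi : d.-tuple (measurableTypeR R) -> bool) : Prop :=
  measurable_fun setT psi.

Definition valid_test (n : nat) (alpha : R)
    (psi : d.-tuple (measurableTypeR R) -> bool) : Prop :=
  (gaussian_law n 0 [set x | psi x = true] <= alpha%:E)%E.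

Definition powerful_test (n : nat) (beta : R) (H1 : set 'cV[R]_d)
    (psi : d.-tuple (measurableTypeR R) -> bool) : Prop :=
  (ereal_sup [set gaussian_law n theta [set x | psi x = false]
             | theta in H1] < beta%:E)%E.

Definition testable (n : nat) (alpha beta : R) (H1 : set 'cV[R]_d) : Prop :=
  exists psi, [/\ is_test psi, valid_test n alpha psi
                & powerful_test n beta H1 psi].

End Testing.

Section Predictions.
Context (R : realType) (d m : nat).
Implicit Types (theta_hat : 'I_m -> 'cV[R]_d) (r : 'I_m -> R).

Definition l2sphere (e : R) : set 'cV[R]_d := [set theta | l2norm theta = e].

Definition pred_balls theta_hat r : set 'cV[R]_d :=
  [set theta | forall i, l2norm (theta - theta_hat i) <= r i].

Definition Uhat theta_hat : 'M[R]_(d, m) :=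
  \matrix_(k < d, i < m) ((l2norm (theta_hat i))^-1 *: theta_hat i) k 0.

Definition gamma_sq theta_hat (e : R) r : \bar R :=
  ereal_inf [set (l2norm (orth_proj (Uhat theta_hat) *m theta) ^+ 2)%:E
            | theta in l2sphere e `&` pred_balls theta_hat r].

(* in \bar R the library has [0^-1 = +oo] and [ereal_inf set0 = +oo] *)
Definition sep_radius (n : nat) (C2 : R) theta_hat r : \bar R :=
  ereal_inf [set e%:E | e in [set e : R | [/\ 0 <= e,
    (C2%:E * Order.min ((Num.sqrt m%:R)%:E / gamma_sq theta_hat e r)
                       ((Num.sqrt d%:R)%:E / (e ^+ 2)%:E) <= n%:R%:E)%E
    & l2sphere e `&` pred_balls theta_hat r !=set0]]].

Definition nonneg_radii r : Prop := forall i, 0 <= r i.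

Definition separation_curve (eps : ('I_m -> R) -> R) : Prop :=
  forall r, nonneg_radii r -> 0 <= eps r.

Definition alternative theta_hat (eps : ('I_m -> R) -> R) : set 'cV[R]_d :=
  [set theta | exists r, [/\ nonneg_radii r,
    l2sphere (eps r) `&` pred_balls theta_hat r !=set0,
    eps r <= l2norm theta & pred_balls theta_hat r theta]].

End Predictions.

(* Main.v *)
Require Import Defs.
From mathcomp Require Import measurable_realfun ring lra.

Set Implicit Arguments.
Unset Strict Implicit.
Unset Printing Implicit Defensive.

Import Order.TTheory GRing.Theory Num.Theory.
Import numFieldNormedType.Exports.
Local Open Scope classical_set_scope.
Local Open Scope ring_scope.

(** The test rejects when one of two chi-square statistics is too large:
    [n * |U^T X|^2] with [U] the normalized predictions, which has [m] degrees
    of freedom, or [n * |X|^2], which has [d]. In both cases the statistic is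
    compared with its null mean plus [c] times the square root of its number
    of degrees of freedom, which is the order of its null standard deviation.

    Statistics. For [U] with [k] orthonormal columns, the statistic centred at
    its mean under [theta] is a quadratic-plus-linear polynomial in independent
    standard normal variables, with variance at most
    [K * k + 4 * v * n * |U^T theta|^2] ([proj_stat_second_moment]). Chebyshev's
    inequality then makes the level small when [c] is large
    ([chi2_test_level]) and gives power as soon as
    [n * |U^T theta|^2 >= 2 * c * sqrt k] ([chi2_test_power]). The variance is
    computed by integrating out one coordinate at a time
    ([product_law_quad_form_sqr]), so that only moments of a single normal
    variable of order at most four occur.

    Geometry. It remains to see that every [theta] of the alternative satisfies
    this last inequality for one of the two choices of [U]
    ([alternative_signal]). Since the predictions are orthogonal, being in the
    balls of radii [r] and on the sphere of radius [e] means that the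
    coordinate of [theta] along the [i]-th prediction is at least
    [a_i(e) = (e^2 + h_i^2 - r_i^2) / (2 h_i)], with [h_i] the length of the
    prediction. As [m < d], there is room orthogonally to the predictions to
    adjust the length, so that [gamma_sq e = sum_i max(a_i(e), 0)^2] whenever
    the sphere of radius [e] meets the balls, and this is nondecreasing in [e]
    ([gamma_sq_le]). If [theta] is in the balls of radii
    [r] and [|theta| >= eps r >= 2 * sep_radius r], some [e <= |theta|]
    satisfies the inequality defining the separation radius
    ([sep_radius_attained]), and that inequality is inherited by
    [|Pi theta|^2 >= gamma_sq e] or by [|theta|^2 >= e^2]. The factor [2] leaves
    the room to reach the infimum, which is positive because
    [gamma_sq e <= e^2]. *)

(** * Moments of one normal variable *)

Section NormalIntegral.
Context {R : realType}.
Implicit Types (m s : R) (f g : R -> R).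
Notation mu := (@lebesgue_measure R).

(** The density of [normal_prob] and its Radon-Nikodym derivative have the same
    integral over every measurable set, hence agree almost everywhere. *)
Lemma integral_normal_prob m s f : measurable_fun setT f ->
  (forall x, 0 <= f x) ->
  (\int[normal_prob m s]_x (f x)%:E =
   \int[mu]_x (f x * normal_pdf m s x)%:E)%E.
Proof.
move=> mf f0; have dom := normal_prob_dominates m s.
rewrite -(Radon_Nikodym_SigmaFinite.change_of_variables dom)//;
  last exact/measurable_EFinP.
apply: ae_eq_integral => //.
- apply: emeasurable_funM; first exact/measurable_EFinP.
  exact: (measurable_int _ (Radon_Nikodym_SigmaFinite.f_integrable dom)).
- by apply/measurable_EFinP/measurable_funM => //; exact: measurable_normal_pdf.
under [X in ae_eq _ _ _ X]eq_fun do rewrite EFinM.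
apply: ae_eqe_mul2l; apply: integral_ae_eq => //.
- exact: Radon_Nikodym_SigmaFinite.f_integrable.
- by apply/measurable_EFinP; exact: measurable_normal_pdf.
- by move=> E _ mE; rewrite -Radon_Nikodym_SigmaFinite.f_integral.
Qed.

Lemma integral_normal_prob_standardize m s g : 0 < s -> continuous g ->
  (forall x, 0 <= g x) ->
  (\int[normal_prob m s]_x (g ((x - m) / s))%:E =
   \int[normal_prob 0 1]_x (g x)%:E)%E.
Proof.
move=> s0 cg g0.
have s_neq0 : s != 0 by rewrite gt_eqF.
(* The substitution y = (x - m) / s turns one density into the other. *)
pose F (x : R^o) : R^o := (x - m) / s.
have F'E : F^`()%classic = cst s^-1.
  apply/funext => x; rewrite /F derive1E deriveM// deriveD// derive_cst scaler0.
  by rewrite add0r derive_id derive_cst addr0 scaler1.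
have cF : continuous F.
  move=> x; apply: cvgM; last exact: cvg_cst.
  by apply: (@cvgB _ R^o) => //; exact: cvg_cst.
have cpdf : continuous (fun x => g x * normal_pdf 0 1 x).
  move=> x; apply: cvgM; first exact: cg.
  by apply: continuous_normal_pdf; rewrite oner_neq0.
have mg : measurable_fun setT g by exact: continuous_measurable_fun.
rewrite !integral_normal_prob//; last first.
  by apply: measurableT_comp => //; exact: continuous_measurable_fun.
rewrite [RHS](increasing_ge0_integration_by_substitutionT (F := F))//.
- apply: eq_integral => x _; congr EFin.
  rewrite F'E !fctE -mulrA; congr (_ * _).
  rewrite !normal_pdfE ?oner_neq0// /normal_peak /normal_fun subr0 /F.
  rewrite !expr1n mul1r -mulrnAr (sqrtrM _ (sqr_ge0 s)) sqrtr_sqr gtr0_norm//.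
  rewrite invfM -mulrA [LHS]mulrC; congr (_ * expR _ / _).
  by field.
- by move=> x y xy; rewrite /F ltr_pM2r ?invr_gt0// ltrD2r.
- by rewrite F'E => ?; exact: cvg_cst.
- by rewrite F'E; exact: is_cvg_cst.
- by rewrite F'E; exact: is_cvg_cst.
- by apply/gt0_cvgMlNy; [rewrite invr_gt0|exact: cvg_addrr_Ny].
- by apply/gt0_cvgMly; [rewrite invr_gt0|exact: cvg_addrr].
- by move=> x; rewrite mulr_ge0// normal_pdf_ge0.
Qed.

End NormalIntegral.

Section NormalMoments.
Context {R : realType}.
Notation mu := (@lebesgue_measure R).
Notation stdnormal := (@normal_prob R 0 1).

Lemma ge0_integralT_fold (h : R -> R) : continuous h -> (forall x, 0 <= h x) ->
  (\int[mu]_x (h x)%:E = \int[mu]_(x in `[0%R, +oo[) (h (- x))%:E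
                       + \int[mu]_(x in `[0%R, +oo[) (h x)%:E)%E.
Proof.
move=> ch h0; have mh : measurable_fun setT h by exact: continuous_measurable_fun.
rewrite -{1}(setUv `]-oo, (0 : R)]) ge0_integral_setU//=; last 4 first.
- exact: measurableC.
- by apply/measurable_EFinP; rewrite setUv.
- by move=> x _; rewrite lee_fin.
- exact/disj_setPCl.
rewrite setCitvl -{1}oppr0 ge0_integration_by_substitutionNy//; last first.
  exact: continuous_subspaceT.
by rewrite integral_itv_obnd_cbnd//; exact/measurable_EFinP/measurable_funTS.
Qed.

Lemma ge0_integral_stdnormal_opp (g : R -> R) : continuous g ->
  (forall x, 0 <= g x) ->
  (\int[stdnormal]_x (g (- x))%:E = \int[stdnormal]_x (g x)%:E)%E.
Proof.
move=> cg g0.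
have cgN : continuous (fun x => g (- x)).
  by move=> x; apply: continuous_comp; [exact: opp_continuous|exact: cg].
have cpdf : continuous (@normal_pdf R 0 1).
  by apply: continuous_normal_pdf; rewrite oner_neq0.
have pdfN x : normal_pdf 0 1 (- x) = normal_pdf 0 1 x :> R.
  by rewrite !normal_pdfE ?oner_neq0// /normal_fun !subr0 sqrrN.
rewrite !integral_normal_prob//; [|exact: continuous_measurable_fun..].
rewrite ge0_integralT_fold; last 2 first.
- by move=> x; apply: cvgM; [exact: cgN|exact: cpdf].
- by move=> x; rewrite mulr_ge0// normal_pdf_ge0.
rewrite [RHS]ge0_integralT_fold; last 2 first.
- by move=> x; apply: cvgM; [exact: cg|exact: cpdf].
- by move=> x; rewrite mulr_ge0// normal_pdf_ge0.
rewrite addeC; congr (_ + _)%E; apply: eq_integral => x _.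
- by rewrite pdfN.
- by rewrite opprK pdfN.
Qed.

(** Square [1 + y^2 / 8 <= exp (y^2 / 8)]. The constant [4] in the exponent
    makes [y^4 * exp (- y^2 / 2)] dominated by a normal density of
    variance [2]. *)
Lemma quartic_le_expR (y : R) : y ^+ 4 <= 64 * expR (y ^+ 2 / 4).
Proof.
have y2 := sqr_ge0 y.
have -> : y ^+ 2 / 4 = y ^+ 2 / 8 + y ^+ 2 / 8 by field.
rewrite expRD -expr2.
have h : 1 + y ^+ 2 / 8 <= expR (y ^+ 2 / 8) by exact: expR_ge1Dx.
have h2 : (y ^+ 2 / 8) ^+ 2 <= expR (y ^+ 2 / 8) ^+ 2.
  by rewrite lerXn2r// ?nnegrE ?expR_ge0//; lra.
rewrite (_ : y ^+ 4 = 64 * (y ^+ 2 / 8) ^+ 2); last by field.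
by rewrite ler_pM2l.
Qed.

Lemma stdnormal_integrable4 : stdnormal.-integrable setT (fun y : R => (y ^+ 4)%:E).
Proof.
have m4 : measurable_fun setT (fun y : R => y ^+ 4) by exact: measurable_funX.
have y4 (y : R) : 0 <= y ^+ 4 by rewrite exprn_even_ge0.
apply/integrableP; split; first exact/measurable_EFinP.
under eq_integral do rewrite gee0_abs ?lee_fin//.
rewrite integral_normal_prob//.
pose s : R := Num.sqrt 2.
have s2 : s ^+ 2 = 2 by rewrite sqr_sqrtr.
have s0 : s != 0 by rewrite gt_eqF// sqrtr_gt0.
pose K : R := 64 * normal_peak 1 / normal_peak s.
have ps : 0 < normal_peak s by exact: normal_peak_gt0.
have p1 : 0 < normal_peak (1 : R) by apply: normal_peak_gt0; exact: oner_neq0.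
apply: (@le_lt_trans _ _ (\int[mu]_y (K%:E * (normal_pdf 0 s y)%:E))%E).
  apply: ge0_le_integral => //.
  - by move=> y _; rewrite lee_fin mulr_ge0// normal_pdf_ge0.
  - apply/measurable_EFinP/measurable_funM => //.
    exact: measurable_normal_pdf.
  - apply/measurable_EFinP/measurable_funM => //.
    exact: measurable_normal_pdf.
  move=> y _; rewrite -EFinM lee_fin !normal_pdfE ?oner_neq0//.
  have -> : K * (normal_peak s * normal_fun 0 s y) =
      normal_peak 1 * (64 * normal_fun 0 s y).
    by rewrite /K; field; rewrite gt_eqF.
  rewrite mulrCA ler_pM2l// /normal_fun s2 !subr0 expr1n.
  have -> : - y ^+ 2 / (1 *+ 2) = - (y ^+ 2 / 4) - y ^+ 2 / 4 by field.
  have -> : - y ^+ 2 / (2 *+ 2) = - (y ^+ 2 / 4) by field.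
  rewrite expRD expRN; have e0 := expR_gt0 (y ^+ 2 / 4).
  rewrite mulrCA mulrC ler_pM2r ?invr_gt0// ler_pdivrMr//.
  exact: quartic_le_expR.
rewrite integralZl//; last exact: integrable_normal_pdf.
by rewrite integral_normal_pdf mule1 ltry.
Qed.

Lemma stdnormal_integrable2 : stdnormal.-integrable setT (fun y : R => (y ^+ 2)%:E).
Proof.
apply: (@le_integrable _ _ R stdnormal _ measurableT _
  (fun y : R => (1 + y ^+ 4)%:E)) => //.
- by apply/measurable_EFinP; exact: measurable_funX.
- move=> y _ /=; rewrite lee_fin !ger0_norm ?sqr_ge0//; last first.
    by rewrite addr_ge0// exprn_even_ge0.
  have := sqr_ge0 (y ^+ 2 - 1); have := sqr_ge0 y; nra.
- under eq_fun do rewrite EFinD.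
  apply: integrableD => //; last exact: stdnormal_integrable4.
  by apply: finite_measure_integrable_cst.
Qed.

Lemma continuous_quadratic_sqr (v A B C : R) :
  continuous (fun y : R => (A * (y ^+ 2 - v) + B * y + C) ^+ 2).
Proof.
move=> y; apply: (@continuous_comp _ _ _ (fun z : R => A * (z ^+ 2 - v) + B * z + C)
    (fun z : R => z ^+ 2)); last exact: exprn_continuous.
  apply: cvgD; last exact: cvg_cst.
  apply: cvgD; apply: cvgM; (try exact: cvg_cst); last exact: cvg_id.
  by apply: cvgB; [exact: exprn_continuous|exact: cvg_cst].
Qed.

(** The monomials [y^2 - v], [y] and [1] are orthogonal for the standard normal
    law, with squared norms [t], [v] and [1]. Here [v] is the second moment and
    [t] the variance of [y^2]; both enter the test only as constants, so that
    their values [1] and [2] are left abstract. *)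
Lemma stdnormal_quadratic_sqr : exists v t : R, [/\ 0 <= v, 0 <= t &
  forall A B C : R,
  (\int[stdnormal]_y ((A * (y ^+ 2 - v) + B * y + C) ^+ 2)%:E =
   (t * A ^+ 2 + v * B ^+ 2 + C ^+ 2)%:E)%E].
Proof.
have i2 := stdnormal_integrable2; have i4 := stdnormal_integrable4.
pose v := fine (\int[stdnormal]_y (y ^+ 2)%:E)%E.
pose w := fine (\int[stdnormal]_y (y ^+ 4)%:E)%E.
have vE : (\int[stdnormal]_y (y ^+ 2)%:E = v%:E)%E.
  by rewrite fineK//; exact: integrable_fin_num.
have wE : (\int[stdnormal]_y (y ^+ 4)%:E = w%:E)%E.
  by rewrite fineK//; exact: integrable_fin_num.
have biquad a b c :
    (\int[stdnormal]_y (a * y ^+ 4 + b * y ^+ 2 + c)%:E = (a * w + b * v + c)%:E)%E.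
  under eq_integral do rewrite !EFinD !EFinM.
  have ib : stdnormal.-integrable setT (fun y => (b%:E * (y ^+ 2)%:E)%E).
    exact: integrableZl.
  have ia : stdnormal.-integrable setT (fun y => (a%:E * (y ^+ 4)%:E)%E).
    exact: integrableZl.
  rewrite integralD//; last 2 first.
  - exact: integrableD.
  - exact: finite_measure_integrable_cst.
  rewrite integralD// !integralZl// vE wE integral_cst//.
  rewrite [X in (_ + _ * X)%E](probability_setT (normal_prob 0 1)) mule1.
  by rewrite !EFinD !EFinM.
have mean A B C :
    (\int[stdnormal]_y ((A * (y ^+ 2 - v) + B * y + C) ^+ 2)%:E =
     ((w - v ^+ 2) * A ^+ 2 + v * B ^+ 2 + C ^+ 2)%:E)%E.
  (* Averaging the integrand with its reflection removes the odd powers, so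
     that no odd moment has to be computed. *)
  pose h (y : R) := (A * (y ^+ 2 - v) + B * y + C) ^+ 2.
  have ch : continuous h by exact: continuous_quadratic_sqr.
  have h0 y : 0 <= h y by exact: sqr_ge0.
  have mh : measurable_fun setT h by exact: continuous_measurable_fun.
  have -> : (\int[stdnormal]_y (h y)%:E =
      \int[stdnormal]_y ((h y + h (- y)) / 2)%:E)%E.
    have hN : measurable_fun setT (fun y : R => h (- y)).
      exact: measurableT_comp.
    under [RHS]eq_integral do rewrite mulrC EFinM EFinD.
    rewrite ge0_integralZl//; last 2 first.
    - by apply: emeasurable_funD; exact/measurable_EFinP.
    - by move=> y _; rewrite adde_ge0// lee_fin.
    rewrite ge0_integralD//; last 4 first.
    - by move=> y _; rewrite lee_fin.
    - exact/measurable_EFinP.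
    - by move=> y _; rewrite lee_fin.
    - exact/measurable_EFinP.
    have I0 : (0 <= \int[stdnormal]_y (h y)%:E)%E.
      by apply: integral_ge0 => y _; rewrite lee_fin.
    rewrite ge0_integral_stdnormal_opp// ge0_muleDr// -ge0_muleDl ?lee_fin//.
    by rewrite -EFinD (_ : 2^-1 + 2^-1 = 1) ?mul1e//; field.
  under eq_integral => y _.
    rewrite (_ : _ / 2 = A ^+ 2 * y ^+ 4
      + (B ^+ 2 + 2 * A * C - 2 * A ^+ 2 * v) * y ^+ 2 + (C - A * v) ^+ 2);
      last by rewrite /h; field.
    over.
  by rewrite biquad; congr EFin; ring.
exists v, (w - v ^+ 2); split => //.
- by rewrite fine_ge0// integral_ge0// => y _; rewrite lee_fin sqr_ge0.
- have := mean 1 0 0; rewrite expr1n mulr1 expr0n/= mulr0 !addr0 => h.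
  rewrite -lee_fin -h integral_ge0// => y _; rewrite lee_fin sqr_ge0//.
Qed.
End NormalMoments.

(** * Second moments of quadratic forms under product laws *)

Section ProductLawIntegral.
Context {R : realType}.
Notation mR := (measurableTypeR R).

Lemma integral_product_lawS k (P : 'I_k.+1 -> probability mR R)
    (f : k.+1.-tuple mR -> R) : measurable_fun setT f -> (forall t, 0 <= f t) ->
  (\int[product_law P]_t (f t)%:E =
   \int[product_law (fun i => P (lift ord0 i))]_t
     \int[P ord0]_x (f (tcons (x, t)))%:E)%E.
Proof.
move=> mf f0.
have mft : measurable_fun setT (fun p : mR * k.-tuple mR => (f (tcons p))%:E).
  by apply/measurable_EFinP; apply: measurableT_comp => //; exact: measurable_tcons.
rewrite [LHS]ge0_integral_distribution//; last first.
  exact/measurable_EFinP.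
rewrite fubini_tonelli2; [by []|exact: mft|by move=> p /=; rewrite lee_fin].
Qed.

(** The term [v] is subtracted on the diagonal so that the quadratic part has
    mean zero when the [y i] are independent, centred and of variance [v]. *)
Definition quad_form k (v : R) (M : 'I_k -> 'I_k -> R) (b : 'I_k -> R) (c : R)
    (y : 'I_k -> R) : R :=
  \sum_i \sum_j M i j * (y i * y j - v *+ (i == j)) + \sum_i b i * y i + c.

Lemma measurable_quad_form k v M b c (g : 'I_k -> mR -> R) :
  (forall i, measurable_fun setT (g i)) ->
  measurable_fun setT
    (fun t : k.-tuple mR => quad_form v M b c (fun i => g i (tnth t i))).
Proof.
move=> mg.
have mgt i : measurable_fun setT (fun t : k.-tuple mR => g i (tnth t i)).
  by apply: measurableT_comp => //; exact: measurable_tnth.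
apply: measurable_funD => //; apply: measurable_funD => //.
  apply: measurable_sum => i; apply: measurable_sum => j.
  apply: measurable_funM => //; apply: measurable_funB => //.
  exact: measurable_funM.
by apply: measurable_sum => i; apply: measurable_funM.
Qed.

(** As a polynomial in the first variable alone, a quadratic form has degree two,
    and its coefficients of degree one and zero are again forms in the remaining
    variables. This is what makes an induction on the dimension possible. *)
Lemma quad_formS k (v : R) (M : 'I_k.+1 -> 'I_k.+1 -> R) b c (y : 'I_k.+1 -> R) :
  let y' i := y (lift ord0 i) in
  quad_form v M b c y =
  M ord0 ord0 * (y ord0 ^+ 2 - v)
  + quad_form v (fun _ _ => 0)
      (fun j => M ord0 (lift ord0 j) + M (lift ord0 j) ord0) (b ord0) y' * y ord0
  + quad_form v (fun i j => M (lift ord0 i) (lift ord0 j))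
      (fun i => b (lift ord0 i)) c y'.
Proof.
pose y' i := y (lift ord0 i); rewrite -/y' /quad_form /=.
have -> : \sum_i \sum_j M i j * (y i * y j - v *+ (i == j)) =
    M ord0 ord0 * (y ord0 ^+ 2 - v)
    + (\sum_j M ord0 (lift ord0 j) * y' j) * y ord0
    + (\sum_i M (lift ord0 i) ord0 * y' i) * y ord0
    + \sum_i \sum_j M (lift ord0 i) (lift ord0 j) *
        (y' i * y' j - v *+ (i == j)).
  rewrite big_ord_recl big_ord_recl eqxx mulr1n -expr2 -!addrA.
  congr (_ + (_ + _)).
    by rewrite mulr_suml; apply: eq_bigr => j _; rewrite subr0 mulrCA mulrC.
  rewrite mulr_suml -big_split; apply: eq_bigr => i _ /=.
  rewrite big_ord_recl; congr (_ + _); first by rewrite subr0 mulrA.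
rewrite [X in _ = _ + (X + _ + _) * _ + _]big1; last first.
  by move=> i _; rewrite big1// => j _; rewrite mul0r.
rewrite [\sum_i b i * _]big_ord_recl.
under [\sum_i (_ + _) * _]eq_bigr do rewrite mulrDl.
by rewrite big_split /= -/y'; ring.
Qed.

(** The cross products [y i * y j] with [i < j] appear with coefficient
    [M i j + M j i] and have variance [v ^+ 2]; by
    [(p + q)^2 <= 2 * (p^2 + q^2)] they cost at most [2 * v ^+ 2] per entry of
    [M], and the diagonal terms cost [t]. The hypothesis on [g] is the
    orthogonality of [g ^+ 2 - v], [g] and [1] for each marginal law. *)
Lemma product_law_quad_form_sqr (v t K : R) k (P : 'I_k -> probability mR R)
    (g : 'I_k -> mR -> R) M b c :
  0 <= v -> 0 <= t -> t <= K -> 2 * v ^+ 2 <= K ->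
  (forall i, measurable_fun setT (g i)) ->
  (forall i A B C, (\int[P i]_x ((A * (g i x ^+ 2 - v) + B * g i x + C) ^+ 2)%:E =
     (t * A ^+ 2 + v * B ^+ 2 + C ^+ 2)%:E)%E) ->
  (\int[product_law P]_x ((quad_form v M b c (fun i => g i (tnth x i))) ^+ 2)%:E <=
   (K * \sum_i \sum_j M i j ^+ 2 + v * \sum_i b i ^+ 2 + c ^+ 2)%:E)%E.
Proof.
move=> v0 t0 tK vK; elim: k P g M b c => [|k IH] P g M b c mg mom.
  rewrite /quad_form !big_ord0 /= !mulr0 !add0r.
  under eq_integral do rewrite /quad_form !big_ord0 !add0r.
  by rewrite integral_cst// [X in (_ * X)%E](probability_setT (product_law P)) mule1.
rewrite integral_product_lawS; last 2 first.
- by apply: measurable_funX; exact: measurable_quad_form.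
- by move=> ?; exact: sqr_ge0.
pose g' i := g (lift ord0 i).
pose L x := quad_form v (fun _ _ => 0)
      (fun j => M ord0 (lift ord0 j) + M (lift ord0 j) ord0) (b ord0)
      (fun i => g' i (tnth x i)).
pose Q x := quad_form v (fun i j => M (lift ord0 i) (lift ord0 j))
      (fun i => b (lift ord0 i)) c (fun i => g' i (tnth x i)).
have mL : measurable_fun setT L by apply: measurable_quad_form => i; exact: mg.
have mQ : measurable_fun setT Q by apply: measurable_quad_form => i; exact: mg.
have inner x : (\int[P ord0]_y
    ((quad_form v M b c (fun i => g i (tnth (tcons (y, x)) i))) ^+ 2)%:E =
    (t * M ord0 ord0 ^+ 2 + v * L x ^+ 2 + Q x ^+ 2)%:E)%E.
  rewrite -(mom ord0); apply: eq_integral => y _; congr ((_ ^+ 2)%:E).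
  rewrite quad_formS tnth0.
  have -> // : (fun i : 'I_k => g (lift ord0 i) (tnth (tcons (y, x)) (lift ord0 i)))
      = (fun i : 'I_k => g' i (tnth x i)).
  by apply/funext => i; rewrite tnthS.
rewrite (eq_integral
    (fun x => ((t * M ord0 ord0 ^+ 2)%:E + v%:E * (L x ^+ 2)%:E + (Q x ^+ 2)%:E)%E));
  last by move=> x _; rewrite inner.
have mL2 : measurable_fun setT (fun x => (L x ^+ 2)%:E).
  by apply/measurable_EFinP; exact: measurable_funX.
have mQ2 : measurable_fun setT (fun x => (Q x ^+ 2)%:E).
  by apply/measurable_EFinP; exact: measurable_funX.
have tM0 : 0 <= t * M ord0 ord0 ^+ 2 by rewrite mulr_ge0// sqr_ge0.
rewrite ge0_integralD//; last 3 first.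
- by move=> x _; rewrite adde_ge0 ?mule_ge0// lee_fin// sqr_ge0.
- by apply: emeasurable_funD => //; exact: measurable_funeM.
- by move=> x _; rewrite lee_fin sqr_ge0.
rewrite ge0_integralD//; last 2 first.
- by move=> x _; rewrite mule_ge0// lee_fin sqr_ge0.
- exact: measurable_funeM.

rewrite integral_cst// [X in (_ * X)%E](probability_setT _) mule1.
rewrite ge0_integralZl//; last by move=> x _; rewrite lee_fin sqr_ge0.
have mg' i : measurable_fun setT (g' i) by exact: mg.
pose P' i := P (lift ord0 i).
have mom' i A B C : (\int[P' i]_x ((A * (g' i x ^+ 2 - v) + B * g' i x + C) ^+ 2)%:E =
     (t * A ^+ 2 + v * B ^+ 2 + C ^+ 2)%:E)%E by exact: mom.
have IL := IH P' g' (fun _ _ => 0)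
  (fun j => M ord0 (lift ord0 j) + M (lift ord0 j) ord0) (b ord0) mg' mom'.
have IQ := IH P' g' (fun i j => M (lift ord0 i) (lift ord0 j))
  (fun i => b (lift ord0 i)) c mg' mom'.
apply: le_trans (leeD (leeD (le_refl _) (lee_wpmul2l _ IL)) IQ) _ => //.
rewrite -EFinM -!EFinD lee_fin.
rewrite [X in K * X + v * _ + _]big1; last first.
  by move=> i _; rewrite big1// => j _; rewrite expr0n.
rewrite big_ord_recl [\sum_(j < k.+1) M ord0 j ^+ 2]big_ord_recl.
under [X in _ <= K * (_ + X) + _ + _]eq_bigr do rewrite big_ord_recl.
rewrite big_split/= [\sum_(i < k.+1) b i ^+ 2]big_ord_recl.
have : v ^+ 2 * \sum_i (M ord0 (lift ord0 i) + M (lift ord0 i) ord0) ^+ 2 <=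
    K * (\sum_i M ord0 (lift ord0 i) ^+ 2 + \sum_i M (lift ord0 i) ord0 ^+ 2).
  rewrite -big_split/= !mulr_sumr; apply: ler_sum => i _.
  set p := M _ _; set q := M _ _.
  apply: (@le_trans _ _ (2 * v ^+ 2 * (p ^+ 2 + q ^+ 2))).
    have := sqr_ge0 (v * (p - q)); nra.
  by rewrite ler_wpM2r// addr_ge0 ?sqr_ge0.
have : t * M ord0 ord0 ^+ 2 <= K * M ord0 ord0 ^+ 2 by rewrite ler_wpM2r ?sqr_ge0.
lra.
Qed.

End ProductLawIntegral.

(** * The Euclidean inner product *)

Section DotProduct.
Context {R : realType}.

Lemma dotvC d (u w : 'cV[R]_d) : dotv u w = dotv w u.
Proof. by apply: eq_bigr => i _; rewrite mulrC. Qed.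

Lemma dotvDl d (u w z : 'cV[R]_d) : dotv (u + w) z = dotv u z + dotv w z.
Proof. by rewrite -big_split; apply: eq_bigr => i _; rewrite mxE mulrDl. Qed.

Lemma dotvZl d a (u w : 'cV[R]_d) : dotv (a *: u) w = a * dotv u w.
Proof. by rewrite mulr_sumr; apply: eq_bigr => i _; rewrite mxE mulrA. Qed.

Lemma dotvDr d (u w z : 'cV[R]_d) : dotv z (u + w) = dotv z u + dotv z w.
Proof. by rewrite ![dotv z _]dotvC dotvDl. Qed.

Lemma dotvZr d a (u w : 'cV[R]_d) : dotv w (a *: u) = a * dotv w u.
Proof. by rewrite ![dotv w _]dotvC dotvZl. Qed.

Lemma dotv_ge0 d (u : 'cV[R]_d) : 0 <= dotv u u.
Proof. by apply: sumr_ge0 => i _; rewrite -expr2 sqr_ge0. Qed.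

Lemma dotv_mulmx d k (U : 'M[R]_(d, k)) u w : dotv (U *m u) w = dotv u (U^T *m w).
Proof. by rewrite !dotvE trmx_mul mulmxA. Qed.

Lemma dotv_isometry d k (U : 'M[R]_(d, k)) u w : U^T *m U = 1%:M ->
  dotv (U *m u) (U *m w) = dotv u w.
Proof. by move=> U1; rewrite dotv_mulmx mulmxA U1 mul1mx. Qed.

Lemma l2norm_sqr d (u : 'cV[R]_d) : l2norm u ^+ 2 = dotv u u.
Proof. by rewrite sqr_sqrtr// dotv_ge0. Qed.

Lemma dotv_contraction d m (U : 'M[R]_(d, m)) (x : 'cV[R]_d) :
  U^T *m U = 1%:M -> dotv (U^T *m x) (U^T *m x) <= dotv x x.
Proof.
move=> U1; rewrite -subr_ge0; set y := U^T *m x.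
suff <- : dotv (x - U *m y) (x - U *m y) = dotv x x - dotv y y by exact: dotv_ge0.
rewrite -scaleN1r !dotvDl !dotvDr !dotvZl !dotvZr [dotv x (U *m y)]dotvC.
by rewrite dotv_isometry// dotv_mulmx -/y; ring.
Qed.

End DotProduct.

(** * Chi-square tests *)

Section QuadForm.
Context {R : realType}.

Lemma quad_form_mx d (v c : R) (M : 'M[R]_d) (b y : 'cV[R]_d) :
  quad_form v M (b^~ 0) c (y^~ 0) =
  dotv y (M *m y) - v * \tr M + dotv b y + c.
Proof.
rewrite /quad_form; congr (_ + _ + _).
rewrite /dotv /mxtrace mulr_sumr -sumrB; apply: eq_bigr => i _.
rewrite mxE mulr_sumr.
under eq_bigr do rewrite mulrBr.
rewrite sumrB; congr (_ - _).
  by apply: eq_bigr => j _; rewrite mulrCA.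
rewrite (bigD1 i)//= eqxx mulr1n big1 ?addr0 1?mulrC// => j ji.
by rewrite eq_sym (negbTE ji) mulr0.
Qed.

Lemma sum_sqr_mx d e (M : 'M[R]_(d, e)) : \sum_i \sum_j M i j ^+ 2 = \tr (M *m M^T).
Proof.
apply: eq_bigr => i _; rewrite mxE; apply: eq_bigr => j _.
by rewrite mxE expr2.
Qed.

Definition proj_stat d n k (U : 'M[R]_(d, k)) (x : 'cV[R]_d) : R :=
  n%:R * dotv (U^T *m x) (U^T *m x).

(** Write [sqrt n * x = sqrt n * th + y] with [y] the standardized noise and
    expand the square of [U^T (sqrt n * th + y)]. The constant [v * k] is the
    mean of [|U^T y|^2] because the projection [U U^T] has trace [k]. *)
Lemma proj_stat_quad_form d n k (U : 'M[R]_(d, k)) (v : R) (x th : 'cV[R]_d) :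
  U^T *m U = 1%:M ->
  proj_stat n U x - v * k%:R - proj_stat n U th =
  quad_form v (U *m U^T) ((2 * Num.sqrt n%:R *: (U *m U^T *m th))^~ 0) 0
    ((Num.sqrt n%:R *: (x - th))^~ 0).
Proof.
move=> U1; rewrite quad_form_mx /proj_stat.
rewrite mxtrace_mulC U1 mxtrace1 addr0.
set s : R := Num.sqrt n%:R; set y := x - th.
have -> : n%:R = s ^+ 2 by rewrite sqr_sqrtr.
have -> : x = th + y by rewrite addrC subrK.
have UUE w z : dotv (U *m U^T *m w) z = dotv (U^T *m w) (U^T *m z).
  by rewrite -mulmxA dotv_mulmx.
rewrite -!scalemxAr !dotvZl !dotvZr [dotv y _]dotvC !UUE.
rewrite mulmxDr !dotvDl !dotvDr [dotv (U^T *m y) (U^T *m th)]dotvC.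
by ring.
Qed.

End QuadForm.

Section Chi2.
Context {R : realType}.

Lemma markov_sqr d (T : measurableType d) (P : probability T R) (F : T -> R)
    (A : set T) (c e : R) : 0 < c -> measurable A -> measurable_fun setT F ->
  (forall x, A x -> c <= F x ^+ 2) ->
  (\int[P]_x (F x ^+ 2)%:E <= e%:E)%E -> (P A <= (e / c)%:E)%E.
Proof.
move=> c0 mA mF FA Fe.
have mF2 : measurable_fun setT (fun x => (F x ^+ 2)%:E).
  by apply/measurable_EFinP; exact: measurable_funX.
rewrite mulrC EFinM lee_pdivlMl//.
apply: le_trans Fe.
have -> : P A = (\int[P]_x (\1_A x)%:E)%E by rewrite integral_indic// setIT.
rewrite -ge0_integralZl ?lee_fin ?(ltW c0)//; last first.
  by apply/measurable_EFinP; exact: measurable_indic.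
apply: ge0_le_integral => //.
- by move=> x _; rewrite mule_ge0 ?lee_fin// ltW.
- by apply: measurable_funeM; apply/measurable_EFinP; exact: measurable_indic.
- move=> x _; rewrite -EFinM lee_fin indicE.
  have [/set_mem/FA|_] := boolP (x \in A); first by rewrite mulr1.
  by rewrite mulr0 sqr_ge0.
Qed.

(** [v] and [t] are the constants of [stdnormal_quadratic_sqr]. *)
Variables (v t K : R).
Hypotheses (v0 : 0 <= v) (t0 : 0 <= t) (tK : t <= K) (vK : 2 * v ^+ 2 <= K).
Hypothesis stdnormal_moment : forall A B C : R,
  (\int[normal_prob 0 1]_y ((A * (y ^+ 2 - v) + B * y + C) ^+ 2)%:E =
   (t * A ^+ 2 + v * B ^+ 2 + C ^+ 2)%:E)%E.
Notation mR := (measurableTypeR R).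

Definition tcol d (x : d.-tuple mR) : 'cV[R]_d := \col_i tnth x i.

Lemma measurable_proj_stat d n k (U : 'M[R]_(d, k)) :
  measurable_fun setT (fun x : d.-tuple mR => proj_stat n U (tcol x)).
Proof.
apply: measurable_funM => //; apply: measurable_sum => i.
have mi : measurable_fun setT (fun x : d.-tuple mR => (U^T *m tcol x) i 0).
  under eq_fun do rewrite mxE; apply: measurable_sum => j.
  apply: measurable_funM => //; under eq_fun do rewrite mxE.
  exact: measurable_tnth.
exact: measurable_funM.
Qed.

(** The projection [U U^T] has squared Frobenius norm [k], and the linear term
    [2 * sqrt n * U U^T th] has squared length [4 * n * |U^T th|^2]. *)
Lemma proj_stat_second_moment d n k (U : 'M[R]_(d, k)) (th : 'cV[R]_d) :
  (0 < n)%N -> U^T *m U = 1%:M ->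
  (\int[gaussian_law n th]_x
     ((proj_stat n U (tcol x) - v * k%:R - proj_stat n U th) ^+ 2)%:E <=
   (K * k%:R + 4 * v * proj_stat n U th)%:E)%E.
Proof.
move=> n0 U1; set s : R := Num.sqrt n%:R.
have s0 : 0 < s by rewrite sqrtr_gt0 ltr0n.
pose g (i : 'I_d) (x : mR) : R := (x - th i 0) / s^-1.
under eq_integral => x _.
  rewrite proj_stat_quad_form//.
  rewrite (_ : (Num.sqrt n%:R *: (tcol x - th))^~ 0 =
      fun i => g i (tnth x i)); last first.
    by apply/funext => i; rewrite !mxE /g invrK mulrC.
  over.
apply: le_trans (product_law_quad_form_sqr _ _ _ v0 t0 tK vK _ _) _.
- move=> i; apply: measurable_funM => //; exact: measurable_funB.
- move=> i A B C; rewrite -stdnormal_moment.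
  pose h y := (A * (y ^+ 2 - v) + B * y + C) ^+ 2.
  rewrite -(integral_normal_prob_standardize (th i 0) (s := s^-1) (g := h)) ?invr_gt0//.
  + exact: continuous_quadratic_sqr.
  + by move=> ?; exact: sqr_ge0.
rewrite lee_fin expr0n addr0 sum_sqr_mx trmx_mul trmxK.
rewrite mulmxA -[U *m _ *m _]mulmxA U1 mulmx1 mxtrace_mulC U1 mxtrace1.
rewrite lerD2l.
rewrite -/s (_ : \sum_i _ = dotv (2 * s *: (U *m U^T *m th)) (2 * s *: (U *m U^T *m th))).
  rewrite dotvZl dotvZr -mulmxA dotv_isometry// /proj_stat.
  have -> : n%:R = s ^+ 2 by rewrite sqr_sqrtr.
  rewrite [leLHS](_ : _ = 4 * v * (s ^+ 2 * dotv (U^T *m th) (U^T *m th)))//.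
  by ring.
by apply: eq_bigr => i _; rewrite expr2.
Qed.

Definition chi2_test d n k (U : 'M[R]_(d, k)) (c : R) (x : d.-tuple mR) : bool :=
  v * k%:R + c * Num.sqrt k%:R < proj_stat n U (tcol x).

Lemma measurable_chi2_test d n k (U : 'M[R]_(d, k)) c :
  measurable_fun setT (@chi2_test d n k U c).
Proof. by apply: measurable_fun_ltr => //; exact: measurable_proj_stat. Qed.

Lemma measurable_chi2_test_set d n k (U : 'M[R]_(d, k)) c b :
  measurable [set x | @chi2_test d n k U c x = b].
Proof.
rewrite -[X in measurable X]setTI.
exact: (measurable_chi2_test _ _ _ measurableT (Y := [set b])).
Qed.

Lemma chi2_test_level d n k (U : 'M[R]_(d, k)) c :
  (0 < n)%N -> (0 < k)%N -> U^T *m U = 1%:M -> 0 < c ->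
  (gaussian_law n 0 [set x | chi2_test n U c x = true] <= (K / c ^+ 2)%:E)%E.
Proof.
move=> n0 k0 U1 c0.
have kp : 0 < k%:R :> R by rewrite ltr0n.
have M2 := proj_stat_second_moment 0 n0 U1.
have S0 : proj_stat n U 0 = 0 :> R.
  by rewrite /proj_stat mulmx0 -(scale0r 0) dotvZl mul0r mulr0.
rewrite (_ : K / c ^+ 2 = (K * k%:R + 4 * v * proj_stat n U 0) / (c ^+ 2 * k%:R)).
  apply: markov_sqr M2.
  - by rewrite mulr_gt0// exprn_gt0.
  - exact: measurable_chi2_test_set.
  - apply: measurable_funB => //; apply: measurable_funB => //.
    exact: measurable_proj_stat.
  - move=> x /= H; rewrite S0 subr0.
    rewrite (_ : c ^+ 2 * k%:R = (c * Num.sqrt k%:R) ^+ 2); last first.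
      by rewrite exprMn sqr_sqrtr.
    have : 0 <= c * Num.sqrt k%:R by rewrite mulr_ge0 ?sqrtr_ge0// ltW.
    move: H; rewrite /chi2_test; set a := proj_stat _ _ _; set w := _ * Num.sqrt _.
    move=> H w0; rewrite lerXn2r// ?nnegrE; lra.
by rewrite S0; field; rewrite !gt_eqF.
Qed.

(** Accepting forces the centred statistic below [- N / 2], where [N] is the
    signal strength. Its variance [K * k + 4 * v * N] is small compared with
    [N ^+ 2 / 4]: the first term since [N >= 2 * c * sqrt k], the second since
    [N >= 2 * c]. *)
Lemma chi2_test_power d n k (U : 'M[R]_(d, k)) c th :
  (0 < n)%N -> (0 < k)%N -> U^T *m U = 1%:M -> 0 < c ->
  2 * c * Num.sqrt k%:R <= proj_stat n U th ->
  (gaussian_law n th [set x | chi2_test n U c x = false] <=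
   (K / c ^+ 2 + 8 * v / c)%:E)%E.
Proof.
move=> n0 k0 U1 c0; set N := proj_stat n U th => cN.
have kp : 0 < k%:R :> R by rewrite ltr0n.
have sk1 : 1 <= Num.sqrt (k%:R : R) by rewrite -[leLHS]sqrtr1 ler_sqrt ?ler1n.
have K0 : 0 <= K by exact: le_trans tK.
have N0 : 0 < N by nra.
have M2 := proj_stat_second_moment th n0 U1.
apply: le_trans (markov_sqr (c := N ^+ 2 / 4) _ _ _ _ M2) _.
- by rewrite divr_gt0// exprn_gt0.
- exact: measurable_chi2_test_set.
- apply: measurable_funB => //; apply: measurable_funB => //.
  exact: measurable_proj_stat.
- move=> x /negbT; rewrite -leNgt -/N; set a := proj_stat _ _ _ => H.
  rewrite (_ : N ^+ 2 / 4 = (N / 2) ^+ 2); last by field.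
  rewrite -[leRHS]sqrrN lerXn2r// ?nnegrE; lra.
rewrite -/N lee_fin ler_pdivrMr ?divr_gt0 ?exprn_gt0//.
have h1 : K * k%:R <= K / c ^+ 2 * (N ^+ 2 / 4).
  rewrite -mulrA ler_wpM2l// mulrC ler_pdivlMr ?exprn_gt0//.
  rewrite (_ : _ * c ^+ 2 = (2 * c * Num.sqrt k%:R) ^+ 2 / 4); last first.
    by rewrite !exprMn sqr_sqrtr//; field.
  by rewrite ler_pM2r ?invr_gt0// lerXn2r// ?nnegrE; nra.
have h2 : 4 * v * N <= 8 * v / c * (N ^+ 2 / 4).
  have -> : 8 * v / c * (N ^+ 2 / 4) = (2 * v * N) * (N / c) by field; rewrite gt_eqF.
  have : 2 <= N / c by rewrite ler_pdivlMr//; nra.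
  have : 0 <= 2 * v * N by apply: mulr_ge0; [exact: mulr_ge0|exact: ltW].
  nra.
lra.
Qed.

End Chi2.

(** * The geometry of the alternative *)

Section Geometry.
Context {R : realType}.

Lemma l2norm_orth_proj d m (U : 'M[R]_(d, m)) (x : 'cV[R]_d) :
  U^T *m U = 1%:M ->
  l2norm (orth_proj U *m x) ^+ 2 = dotv (U^T *m x) (U^T *m x).
Proof.
move=> U1; rewrite l2norm_sqr; have [a Ha] := orth_proj_span U x.
have := orth_proj_orth U x; rewrite Ha mulmxBr mulmxA U1 mul1mx => /eqP.
by rewrite subr_eq0 => /eqP ->; rewrite dotv_isometry.
Qed.

Lemma exists_unit_orth d m (U : 'M[R]_(d, m)) : (m < d)%N ->
  exists w : 'cV[R]_d, U^T *m w = 0 /\ dotv w w = 1.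
Proof.
move=> md; have : kermx U != 0.
  rewrite -mxrank_eq0 mxrank_ker -lt0n subn_gt0.
  by rewrite (leq_ltn_trans (rank_leq_col U)).
case/rowV0Pn => z /sub_kermxP zU z0.
have w0 : 0 < dotv z^T z^T.
  rewrite lt_def dotv_ge0 andbT; apply: contraNneq z0 => /dotv_eq0/eqP.
  by rewrite trmx_eq0.
exists ((Num.sqrt (dotv z^T z^T))^-1 *: z^T); split.
  by rewrite -scalemxAr -trmx_mul zU trmx0 scaler0.
rewrite dotvZl dotvZr mulrA -invfM -expr2 sqr_sqrtr ?ltW//.
by rewrite mulVf// gt_eqF.
Qed.

Variables (d m : nat) (theta_hat : 'I_m -> 'cV[R]_d).
Hypothesis theta_hat_neq0 : forall i, theta_hat i <> 0.
Hypothesis theta_hat_orth : forall i j, i != j -> dotv (theta_hat i) (theta_hat j) = 0.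
Let U := Uhat theta_hat.
Let h i := l2norm (theta_hat i).

Lemma l2norm_theta_hat_gt0 i : 0 < h i.
Proof.
rewrite sqrtr_gt0 lt_def dotv_ge0 andbT.
by apply/eqP => /dotv_eq0; exact: theta_hat_neq0.
Qed.

Lemma tr_UhatE (x : 'cV[R]_d) i : (U^T *m x) i 0 = (h i)^-1 * dotv (theta_hat i) x.
Proof.
rewrite mxE /dotv mulr_sumr; apply: eq_bigr => k _.
by rewrite !mxE mulrA.
Qed.

Lemma Uhat_orthonormal : U^T *m U = 1%:M.
Proof.
apply/matrixP => i j; have hi := l2norm_theta_hat_gt0 i.
have -> : (U^T *m U) i j = (h i)^-1 * ((h j)^-1 * dotv (theta_hat i) (theta_hat j)).
  rewrite mxE /dotv !mulr_sumr; apply: eq_bigr => k _.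
  by rewrite !mxE; ring.
rewrite !mxE; case: eqVneq => [->|/theta_hat_orth ->]; last by rewrite !mulr0.
rewrite -l2norm_sqr -/(h j); have := l2norm_theta_hat_gt0 j => hj.
by rewrite mulr1n; field; rewrite gt_eqF.
Qed.

(** Expanding [|th - theta_hat i|^2 <= r i ^+ 2] isolates the inner product of
    [th] with the [i]-th prediction: only [|th|] and this coordinate matter. *)
Lemma pred_ballsE (r : 'I_m -> R) (th : 'cV[R]_d) : nonneg_radii r ->
  pred_balls theta_hat r th <->
  forall i, (dotv th th + h i ^+ 2 - r i ^+ 2) / (2 * h i) <= (U^T *m th) i 0.
Proof.
move=> r0.
suff H i : (l2norm (th - theta_hat i) <= r i) =
    ((dotv th th + h i ^+ 2 - r i ^+ 2) / (2 * h i) <= (U^T *m th) i 0).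
  by split=> B i; have := B i; rewrite H.
have hi := l2norm_theta_hat_gt0 i.
rewrite -(@ler_pXn2r _ 2%N)// ?nnegrE ?sqrtr_ge0// l2norm_sqr.
have -> : dotv (th - theta_hat i) (th - theta_hat i) =
    dotv th th - 2 * dotv (theta_hat i) th + h i ^+ 2.
  rewrite -scaleN1r !dotvDl !dotvDr !dotvZl !dotvZr [dotv th (theta_hat i)]dotvC.
  by rewrite /h l2norm_sqr; ring.
rewrite tr_UhatE ler_pdivrMr ?mulr_gt0//.
rewrite (_ : _ * (2 * h i) = 2 * dotv (theta_hat i) th); last by field; rewrite gt_eqF.
by apply/idP/idP; lra.
Qed.

(** The point of radius [e] with coordinates [max (a i) 0] along the predictions,
    completed in an orthogonal direction, is admissible; its projection is
    shorter than that of [th] because the lower bounds on the coordinates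
    increase with the radius. *)
Lemma gamma_sq_le (r : 'I_m -> R) (e : R) (th : 'cV[R]_d) :
  (m < d)%N -> nonneg_radii r -> 0 <= e -> e <= l2norm th ->
  pred_balls theta_hat r th ->
  l2sphere e `&` pred_balls theta_hat r !=set0 ->
  (gamma_sq theta_hat e r <= (dotv (U^T *m th) (U^T *m th))%:E)%E.
Proof.
move=> md r0 e0 eth Bth [th0 [Sth0 Bth0]].
have U1 := Uhat_orthonormal.
pose a i := (e ^+ 2 + h i ^+ 2 - r i ^+ 2) / (2 * h i).
pose p : 'cV[R]_m := \col_i Num.max (a i) 0.
have ple (x : 'cV[R]_d) : e ^+ 2 <= dotv x x -> pred_balls theta_hat r x ->
    dotv p p <= dotv (U^T *m x) (U^T *m x).
  move=> ex /(pred_ballsE _ r0) Bx; apply: ler_sum => i _.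
  have ax : a i <= (U^T *m x) i 0.
    apply: le_trans (Bx i); rewrite ler_pM2r ?invr_gt0 ?mulr_gt0 ?l2norm_theta_hat_gt0//.
    by rewrite lerD2r lerD2r.
  rewrite mxE -!expr2; have [a0|a0] := leP (a i) 0.
    by rewrite expr0n sqr_ge0.
  by rewrite lerXn2r// nnegrE ltW// (lt_le_trans a0).
have pe : dotv p p <= e ^+ 2.
  have Sth0' : dotv th0 th0 = e ^+ 2 by rewrite -l2norm_sqr Sth0.
  apply: le_trans (ple th0 _ Bth0) _; first by rewrite Sth0'.
  by rewrite -Sth0'; exact: dotv_contraction.
(* [x] is the point with coordinates [p] along the predictions and length [e];
   an admissible [th0] on the sphere ensures that [p] is not too long. *)
have [w [Uw w1]] := exists_unit_orth U md.
pose s := Num.sqrt (e ^+ 2 - dotv p p).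
have s2 : s ^+ 2 = e ^+ 2 - dotv p p by rewrite sqr_sqrtr// subr_ge0.
pose x := U *m p + s *: w.
have Ux : U^T *m x = p.
  by rewrite mulmxDr -scalemxAr Uw scaler0 addr0 mulmxA U1 mul1mx.
have xx : dotv x x = e ^+ 2.
  rewrite /x !dotvDl !dotvDr !dotvZl !dotvZr dotv_isometry// w1.
  have -> : dotv w (U *m p) = 0.
    by rewrite dotvC dotv_mulmx Uw -(scale0r 0) dotvZr mul0r.
  have -> : dotv (U *m p) w = 0 by rewrite dotv_mulmx Uw -(scale0r 0) dotvZr mul0r.
  by rewrite !mulr0 addr0 add0r mulr1 -expr2 s2; ring.
apply: (@le_trans _ _ (dotv p p)%:E); last first.
  rewrite lee_fin; apply: ple => //.
  by rewrite -l2norm_sqr lerXn2r// nnegrE sqrtr_ge0.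
apply: ereal_inf_lbound; exists x; last by rewrite l2norm_orth_proj// Ux.
split; first by rewrite /l2sphere /= /l2norm xx sqrtr_sqr ger0_norm.
apply/pred_ballsE => // i; rewrite Ux xx mxE.
by rewrite le_max lexx.
Qed.


Lemma gamma_sq_fin (r : 'I_m -> R) (e : R) :
  l2sphere e `&` pred_balls theta_hat r !=set0 ->
  exists g : R, [/\ gamma_sq theta_hat e r = g%:E, 0 <= g & g <= e ^+ 2].
Proof.
move=> [th [Sth Bth]]; have U1 := Uhat_orthonormal.
have g0 : (0 <= gamma_sq theta_hat e r)%E.
  by apply: le_ereal_inf_tmp => _ [x _ <-]; rewrite lee_fin sqr_ge0.
have ge : (gamma_sq theta_hat e r <= (e ^+ 2)%:E)%E.
  apply: (@le_trans _ _ (l2norm (orth_proj U *m th) ^+ 2)%:E).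
    by apply: ereal_inf_lbound; exists th.
  rewrite lee_fin l2norm_orth_proj//.
  by apply: le_trans (dotv_contraction _ U1) _; rewrite -l2norm_sqr Sth.
have gfin : gamma_sq theta_hat e r \is a fin_num.
  by rewrite ge0_fin_numE// (le_lt_trans ge)// ltry.
exists (fine (gamma_sq theta_hat e r)); split.
- by rewrite fineK.
- by rewrite fine_ge0.
- by rewrite -lee_fin fineK.
Qed.

(** The case [y = 0] is excluded by the hypothesis, as its left-hand side is then
    infinite. *)
Lemma ediv_le_fin (C a y b : R) : 0 < C -> 0 < a -> 0 <= y ->
  (C%:E * (a%:E / y%:E) <= b%:E)%E -> C * a <= b * y.
Proof.
move=> C0 a0 y0; have [->|yn0] := eqVneq y 0.
  by rewrite inve0 !gt0_muley// ?lte_fin// leye_eq.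
by rewrite inver (negbTE yn0) -!EFinM lee_fin mulrA ler_pdivrMr// lt_def yn0.
Qed.

Lemma sep_radius_mem (n : nat) (C2 e : R) (r : 'I_m -> R) :
  (0 < m)%N -> (0 < d)%N -> 0 < C2 -> 
  (C2%:E * Order.min ((Num.sqrt m%:R)%:E / gamma_sq theta_hat e r)
                     ((Num.sqrt d%:R)%:E / (e ^+ 2)%:E) <= n%:R%:E)%E ->
  l2sphere e `&` pred_balls theta_hat r !=set0 ->
  exists g : R, [/\ gamma_sq theta_hat e r = g%:E, g <= e ^+ 2 &
    C2 * Num.sqrt m%:R <= n%:R * g \/ C2 * Num.sqrt d%:R <= n%:R * e ^+ 2].
Proof.
move=> m0 d0 C0 H ne; have [g [gE g0 ge]] := gamma_sq_fin ne.
exists g; split => //; move: H; rewrite gE minEle; case: ifP => _ H.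
  by left; apply: ediv_le_fin H => //; rewrite sqrtr_gt0 ltr0n.
by right; apply: ediv_le_fin H; rewrite ?sqr_ge0// sqrtr_gt0 ltr0n.
Qed.

(** Every member [e] of the set defining the separation radius satisfies
    [C2 * sqrt m <= n * e^2], because [gamma_sq e <= e^2] and [m <= d]. The
    separation radius is therefore positive, and [rho], being at least its
    double, exceeds some member of the set. *)
Lemma sep_radius_attained (n : nat) (C2 rho : R) (r : 'I_m -> R) :
  (0 < n)%N -> (0 < m)%N -> (m < d)%N -> 0 < C2 ->
  (2%:E * sep_radius n C2 theta_hat r <= rho%:E)%E ->
  exists e : R, [/\ 0 <= e, e <= rho,
    l2sphere e `&` pred_balls theta_hat r !=set0 &
    exists g : R, [/\ gamma_sq theta_hat e r = g%:E, g <= e ^+ 2 &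
    C2 * Num.sqrt m%:R <= n%:R * g \/ C2 * Num.sqrt d%:R <= n%:R * e ^+ 2]].
Proof.
move=> n0 m0 md C0 Hrho; have d0 : (0 < d)%N by exact: ltn_trans md.
have np : 0 < n%:R :> R by rewrite ltr0n.
pose delta := Num.sqrt (C2 * Num.sqrt m%:R / n%:R).
have D0 : 0 < C2 * Num.sqrt m%:R / n%:R.
  by rewrite divr_gt0// mulr_gt0// sqrtr_gt0 ltr0n.
have delta0 : 0 < delta by rewrite sqrtr_gt0.
have lb : (delta%:E <= sep_radius n C2 theta_hat r)%E.
  apply: le_ereal_inf_tmp => _ [e [e0 He ne] <-]; rewrite lee_fin.
  have [g [_ ge H]] := sep_radius_mem m0 d0 C0 He ne.
  rewrite -(@ler_pXn2r _ 2%N)// ?nnegrE ?sqrtr_ge0// (sqr_sqrtr (ltW D0)).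
  rewrite ler_pdivrMr// [leRHS]mulrC.
  case: H => [H|H].
    by apply: le_trans H _; rewrite ler_pM2l.
  apply: le_trans H; rewrite ler_pM2l// ler_sqrt ?ler0n// ler_nat.
  exact: ltnW.
have half : (sep_radius n C2 theta_hat r <= (rho / 2)%:E)%E.
  by rewrite mulrC EFinM lee_pdivlMl// mulrC.
have rho0 : 0 < rho.
  have := le_trans lb half; rewrite lee_fin ler_pdivlMr// => h'.
  by apply: lt_le_trans h'; rewrite mulr_gt0.
have : (sep_radius n C2 theta_hat r < rho%:E)%E.
  by apply: le_lt_trans half _; rewrite lte_fin ltr_pdivrMr// ltr_pMr// ltr1n.
move=> /ereal_inf_lt[_ [e [e0 He ne] <-]]; rewrite lte_fin => er.
exists e; split => //; first exact: ltW.
exact: sep_radius_mem.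
Qed.

Lemma alternative_signal (n : nat) (C2 : R) (eps : ('I_m -> R) -> R) (th : 'cV[R]_d) :
  (0 < n)%N -> (0 < m)%N -> (m < d)%N -> 0 < C2 ->
  (forall r, nonneg_radii r -> l2sphere (eps r) `&` pred_balls theta_hat r !=set0 ->
     (2%:E * sep_radius n C2 theta_hat r <= (eps r)%:E)%E) ->
  alternative theta_hat eps th ->
  C2 * Num.sqrt m%:R <= proj_stat n U th \/
  C2 * Num.sqrt d%:R <= proj_stat n (1%:M : 'M[R]_d) th.
Proof.
move=> n0 m0 md C0 sep [r [r0 ne eth Bth]].
have [e [e0 er ne' [g [gE ge]]]] := sep_radius_attained n0 m0 md C0 (sep r r0 ne).
have {}eth : e <= l2norm th by exact: le_trans eth.
have np : 0 < n%:R :> R by rewrite ltr0n.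
case=> H; [left|right]; apply: le_trans H _; rewrite ler_pM2l//.
  by rewrite -lee_fin -gE; exact: gamma_sq_le.
by rewrite trmx1 mul1mx -l2norm_sqr lerXn2r// nnegrE ?sqrtr_ge0.
Qed.

End Geometry.

(** * The combined test *)

Theorem theorem3 (R : realType) (alpha beta : R) :
  0 < alpha -> alpha < 1 -> 0 < beta -> beta < 1 - alpha ->
  exists C1 C2 : R, [/\ 0 < C1, 0 < C2 &
    forall (d n m : nat) (theta_hat : 'I_m -> 'cV[R]_d) (eps : ('I_m -> R) -> R),
      (0 < d)%N -> (0 < n)%N -> (0 < m)%N ->
      (2 * m <= d)%N ->
      (forall i, theta_hat i <> 0) ->
      (forall i j, i != j -> dotv (theta_hat i) (theta_hat j) = 0) ->
      separation_curve eps ->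
      (forall r : 'I_m -> R, nonneg_radii r ->
         l2sphere (eps r) `&` pred_balls theta_hat r !=set0 ->
         (C1%:E * sep_radius n C2 theta_hat r <= (eps r)%:E)%E) ->
      testable n alpha beta (alternative theta_hat eps)].
Proof.
move=> alpha0 _ beta0 _.
have [v [t [v0 t0 mom]]] := @stdnormal_quadratic_sqr R.
pose K := Num.max t (2 * v ^+ 2).
have tK : t <= K by rewrite le_max lexx.
have vK : 2 * v ^+ 2 <= K by rewrite le_max lexx orbT.
have K0 : 0 <= K by exact: le_trans tK.
pose a := Num.min alpha beta.
have a0 : 0 < a by rewrite lt_min alpha0.
(* The level of each test and the error under the alternative are at most
   [(K + 8 * v) / c], and the two levels add up. *)
pose c := 1 + 2 * (K + 8 * v) / a.
have c1 : 1 <= c by rewrite lerDl divr_ge0 ?(ltW a0)// mulr_ge0// addr_ge0// mulr_ge0.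
have c0 : 0 < c by exact: lt_le_trans c1.
have err : K / c ^+ 2 + 8 * v / c <= a / 2.
  have ca : c * a = a + 2 * (K + 8 * v) by rewrite /c; field; rewrite gt_eqF.
  apply: (@le_trans _ _ ((K + 8 * v) / c)).
    rewrite (mulrDl K) lerD2r ler_wpM2l// lef_pV2 ?posrE ?exprn_gt0//.
    by rewrite expr2 ler_pMr.
  by rewrite ler_pdivrMr// mulrAC ler_pdivlMr// [a * c]mulrC ca; lra.
have err1 : K / c ^+ 2 <= a / 2.
  by apply: le_trans err; rewrite lerDl divr_ge0 ?(ltW c0)// mulr_ge0.
exists 2, (2 * c); split; rewrite ?mulr_gt0//.
move=> d n m theta_hat eps d0 n0 m0 md th0 thO _ sep.
have md' : (m < d)%N by apply: leq_trans md; rewrite mul2n -addnn -addn1 leq_add2l.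
have U1 := Uhat_orthonormal th0 thO.
have I1 : (1%:M : 'M[R]_d)^T *m 1%:M = 1%:M by rewrite trmx1 mul1mx.
pose psi1 := chi2_test v n (Uhat theta_hat) c.
pose psi2 := chi2_test v n (1%:M : 'M[R]_d) c.
have mpsi1 b : measurable [set x | psi1 x = b] by exact: measurable_chi2_test_set.
have mpsi2 b : measurable [set x | psi2 x = b] by exact: measurable_chi2_test_set.
have mpsi : measurable_fun setT (fun x => psi1 x || psi2 x).
  by apply: measurable_or; exact: measurable_chi2_test.
have mpsif : measurable [set x | psi1 x || psi2 x = false].
  by rewrite -[X in measurable X]setTI; exact: (mpsi measurableT [set false]).
exists (fun x => psi1 x || psi2 x); split => //.
- rewrite /valid_test.
  apply: (@le_trans _ _ (gaussian_law n 0 [set x | psi1 x = true] +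
                         gaussian_law n 0 [set x | psi2 x = true])%E).
    apply: le_trans (measureU2 _ (mpsi1 _) (mpsi2 _)).
    apply: le_measure; rewrite ?inE.
    + by rewrite -[X in measurable X]setTI; exact: (mpsi measurableT [set true]).
    + exact: measurableU.
    + by move=> x /= /orP.
  apply: le_trans (leeD (chi2_test_level v0 t0 tK vK mom n0 m0 U1 c0)
                        (chi2_test_level v0 t0 tK vK mom n0 d0 I1 c0)) _.
  rewrite -EFinD lee_fin; apply: (@le_trans _ _ a); first by lra.
  by rewrite ge_min lexx.
- apply: (@le_lt_trans _ _ (a / 2)%:E); last first.
    rewrite lte_fin; apply: (@lt_le_trans _ _ a); first by lra.
    by rewrite ge_min lexx orbT.
  apply: ge_ereal_sup => _ [th Hth <-].
  apply: (@le_trans _ _ (K / c ^+ 2 + 8 * v / c)%:E); last by rewrite lee_fin.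
  have C2_gt0 : 0 < 2 * c by rewrite mulr_gt0.
  have [H|H] := alternative_signal th0 thO n0 m0 md' C2_gt0 sep Hth.
  + apply: le_trans (chi2_test_power v0 t0 tK vK mom n0 m0 U1 c0 H).
    by apply: le_measure; rewrite ?inE//; move=> x /= /norP[/negbTE].
  + apply: le_trans (chi2_test_power v0 t0 tK vK mom n0 d0 I1 c0 H).
    by apply: le_measure; rewrite ?inE//; move=> x /= /norP[_ /negbTE].
Qed.
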